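(* Let $n\ge2$, let $e=(1,\ldots,1)^t\in\mathbb{R}^n$, and let $X\in M_{n,n-1}(\mathbb{R})$ be such that $U=\begin{pmatrix}\frac1{\sqrt n}e&X\end{pmatrix}$ is a real orthogonal matrix. Then $$\langle\mathbf{DS}_n\rangle=\left\{U\begin{pmatrix}a&0\\0&B\end{pmatrix}U^{-1}:a\in\mathbb{R},\ B\in M_{n-1}(\mathbb{R})\right\},$$ $$\langle\mathbf{RS}_n\rangle=\left\{U\begin{pmatrix}a&r^t\\0&B\end{pmatrix}U^{-1}:a\in\mathbb{R},\ B\in M_{n-1}(\mathbb{R}),\ r\in\mathbb{R}^{n-1}\right\},$$ $$\langle\mathbf{CS}_n\rangle=\left\{U\begin{pmatrix}a&0\\c&B\end{pmatrix}U^{-1}:a\in\mathbb{R},\ B\in M_{n-1}(\mathbb{R}),\ c\in\mathbb{R}^{n-1}\right\}.$$ In particular, every $A\in M_n(\mathbb{R})$ has $A=A_{\mathbf{DS}}+A_R+A_C$, in which $$A_{\mathbf{DS}}=U\begin{pmatrix}ns_A&0\\0&X^tA_{\mathbf{DS}}X\end{pmatrix}U^{-1},\quad A_R=U\begin{pmatrix}0&\sqrt n\,r(A)^tX\\0&0\end{pmatrix}U^{-1},\quad A_C=U\begin{pmatrix}0&0\\\sqrt n\,X^tc(A)&0\end{pmatrix}U^{-1}.$$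
   Context: $\mathbf{DS}_n$, $\mathbf{RS}_n$, $\mathbf{CS}_n$ are the sets of $n\times n$ doubly stochastic, row stochastic, and column stochastic matrices (real, entrywise nonnegative, with all row and column sums, all row sums, or all column sums, respectively, equal to $1$). $\langle\cdot\rangle$ denotes the real linear span. For $A=[a_{ij}]\in M_n(\mathbb{R})$: $s_A=\frac1{n^2}\sum_{i,j}a_{ij}$; $r(A)=(r_1,\ldots,r_n)^t$ with $r_i=\frac1n\sum_ka_{ki}-s_A$; $c(A)=(c_1,\ldots,c_n)^t$ with $c_i=\frac1n\sum_ka_{ik}-s_A$; and $A_R=e\,r(A)^t$, $A_C=c(A)\,e^t$, $A_{\mathbf{DS}}=A-A_R-A_C$. *)

(* Defs.v *)
From mathcomp Require Import all_boot all_order all_algebra.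
From mathcomp Require Import classical_sets reals.

Set Implicit Arguments.
Unset Strict Implicit.
Unset Printing Implicit Defensive.

Import Order.TTheory GRing.Theory Num.Theory.
Local Open Scope classical_set_scope.
Local Open Scope ring_scope.

(* The library's [<<s>>%VS] only spans a finite list, so the span of an
   arbitrary set collects the spans of all finite lists of its elements. *)
Definition linear_span (K : fieldType) (V : vectType K) (S : set V) : set V :=
  [set v | exists2 s : seq V, {in s, forall x, S x} & v \in <<s>>%VS].

Section Stochastic.
Variables (R : realType) (n : nat).

Definition row_stochastic : set 'M[R]_n :=
  [set A | (forall i j, 0 <= A i j) /\ (forall i, \sum_j A i j = 1)].

Definition col_stochastic : set 'M[R]_n :=
  [set A | (forall i j, 0 <= A i j) /\ (forall j, \sum_i A i j = 1)].

Definition doubly_stochastic : set 'M[R]_n :=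
  row_stochastic `&` col_stochastic.

Definition orthogonal_mx (U : 'M[R]_n) : Prop := U^T *m U = 1%:M.

Definition ones : 'cV[R]_n := const_mx 1.

Implicit Type A : 'M[R]_n.

Definition mx_mean A : R := (n%:R ^+ 2)^-1 * \sum_i \sum_j A i j.

(* The i-th entry of [r_vec A] is built from the i-th column of [A], and that
   of [c_vec A] from the i-th row. *)
Definition r_vec A : 'cV[R]_n := \col_i (n%:R^-1 * \sum_k A k i - mx_mean A).

Definition c_vec A : 'cV[R]_n := \col_i (n%:R^-1 * \sum_k A i k - mx_mean A).

Definition R_part A : 'M[R]_n := ones *m (r_vec A)^T.

Definition C_part A : 'M[R]_n := c_vec A *m ones^T.

Definition DS_part A : 'M[R]_n := A - R_part A - C_part A.

End Stochastic.

Arguments row_stochastic R n : clear implicits.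
Arguments col_stochastic R n : clear implicits.
Arguments doubly_stochastic R n : clear implicits.
Arguments ones R n : clear implicits.

(* Main.v *)
Require Import Defs.
From mathcomp Require Import all_boot all_order all_algebra.
From mathcomp Require Import classical_sets reals.
From mathcomp Require Import lra.

Set Implicit Arguments.
Unset Strict Implicit.
Unset Printing Implicit Defensive.

Import Order.TTheory GRing.Theory Num.Theory.
Local Open Scope classical_set_scope.
Local Open Scope ring_scope.

(** The span of each set of stochastic matrices is the space of all matrices
    whose lines of the given kind have one common sum: this condition is linear,
    and conversely a matrix [M] with common line sum [a] becomes nonnegative
    after a large multiple of the all-ones matrix is added, so that it is a
    combination of just two stochastic matrices ([linear_span_line_sums]).

    Common line sums are an eigenvector condition: all row sums of [M] are [a]
    iff [M e = a e], all column sums iff [M^T e = a e].  In an orthonormal frame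
    [U = (u X)] whose first vector is [u = e / sqrt n], the matrix [U^T M U] has
    blocks [u^T M u], [u^T M X], [X^T M u], [X^T M X]; since [X^T u = 0], the
    condition [M u = a u] says that its first column is [(a, 0)^T], and
    [M^T u = a u] that its first row is [(a, 0)]
    ([frame_right_eigenP], [frame_left_eigenP], [frame_biblockP]).

    For the explicit decomposition, the vectors [r(A)] and [c(A)] are centred,
    i.e. orthogonal to [e].  Hence the outer products [A_R] and [A_C] have a
    single nonzero block each ([frame_outer_row], [frame_outer_col]), and
    removing them from [A] leaves a matrix with all row and column sums equal to
    [n s_A] ([DS_part_ones]). *)

(** * Spans of stochastic matrices *)

Lemma linear_span_min (K : fieldType) (V : vectType K) (S P : set V) :
  P 0 -> (forall (k : K) x y, P x -> P y -> P (k *: x + y)) ->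
  S `<=` P -> linear_span S `<=` P.
Proof.
move=> P0 Plin SP v [s sS /(@coord_span _ _ _ (in_tuple s)) ->].
elim/big_rec: _ => // i x _ Px.
by apply: Plin => //; apply/SP/sS/mem_nth.
Qed.

Lemma linear_span_comb2 (K : fieldType) (V : vectType K) (S : set V)
    (k l : K) (x y : V) : S x -> S y -> linear_span S (k *: x + l *: y).
Proof.
move=> Sx Sy; exists [:: x; y].
  by move=> z; rewrite !inE => /orP[] /eqP ->.
by rewrite memvD// memvZ// memv_span// !inE eqxx ?orbT.
Qed.

Section LineSums.
Variables (R : realType) (n : nat).
Implicit Types M A B : 'M[R]_n.

Lemma mulmx_onesE M (a : R) :
  M *m ones R n = a *: ones R n <-> forall i, \sum_j M i j = a.
Proof.
have E i : (M *m ones R n) i 0 = \sum_j M i j.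
  by rewrite mxE; apply: eq_bigr => j _; rewrite mxE mulr1.
split=> [/matrixP H i|H].
  by rewrite -E H !mxE mulr1.
by apply/matrixP => i j; rewrite ord1 E H !mxE mulr1.
Qed.

Lemma trmx_onesE M (a : R) :
  M^T *m ones R n = a *: ones R n <-> forall j, \sum_i M i j = a.
Proof.
rewrite mulmx_onesE; split=> H i; rewrite -(H i);
  by apply: eq_bigr => j _; rewrite mxE.
Qed.

Lemma le_entry_sum_norm M i j : - M i j <= \sum_k \sum_l `|M k l|.
Proof.
rewrite (bigD1 i)//= (bigD1 j)//= -addrA.
apply: (le_trans (ler_norm _)); rewrite normrN lerDl.
by rewrite addr_ge0 ?sumr_ge0// => k _; rewrite sumr_ge0.
Qed.

(** Here [Q a M] stands for a linear condition saying that certain lines of [M]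
    all sum to [a], and [S] for the nonnegative matrices with these sums equal
    to 1.  If [Q a M] holds, adding a large multiple [k] of the all-ones matrix
    [J] makes [M] nonnegative with positive line sums [b = a + k n], so
    [P = (M + k J) / b] and [J / n] belong to [S] and [M = b P - k n (J / n)]. *)
Lemma linear_span_line_sums (Q : R -> 'M[R]_n -> Prop) (S : set 'M[R]_n) :
  (0 < n)%N ->
  (forall k a b A B, Q a A -> Q b B -> Q (k * a + b) (k *: A + B)) ->
  Q n%:R (const_mx 1) ->
  (forall A, S A <-> (forall i j, 0 <= A i j) /\ Q 1 A) ->
  linear_span S = [set M | exists a, Q a M].
Proof.
move=> n0 Qlin QJ SE.
have n_gt0 : 0 < n%:R :> R by rewrite ltr0n.
have n_neq0 : n%:R != 0 :> R by rewrite gt_eqF.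
have Q0 : Q 0 0.
  by have := Qlin (-1) _ _ _ _ QJ QJ; rewrite mulN1r scaleN1r !addNr.
have QZ k a A : Q a A -> Q (k * a) (k *: A).
  by move=> QA; have := Qlin k _ _ _ _ QA Q0; rewrite !addr0.
apply/seteqP; split=> [|M [a QM]].
  apply: linear_span_min; first by exists 0.
    by move=> k x y [a Qx] [b Qy]; exists (k * a + b); apply: Qlin.
  by move=> A /SE[_ QA]; exists 1.
(* [1 + `|a|] makes [b] positive, and the sum of the [`|M i j|] makes every
   entry of [M + k J] nonnegative. *)
pose k := 1 + `|a| + \sum_i \sum_j `|M i j|.
pose b := a + k * n%:R.
have sum_ge0 : 0 <= \sum_i \sum_j `|M i j|.
  by apply: sumr_ge0 => i _; apply: sumr_ge0.
have k_ge : 1 + `|a| <= k by rewrite lerDl.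
have k_gt0 : 0 < k by apply: lt_le_trans k_ge; rewrite ltr_pwDl.
have b_gt0 : 0 < b.
  have : 1 + `|a| <= k * n%:R.
    by apply: (le_trans k_ge); rewrite ler_peMr ?ler1n// (ltW k_gt0).
  have : - a <= `|a| by rewrite -normrN ler_norm.
  by rewrite /b; lra.
have SJ : S (n%:R^-1 *: const_mx 1).
  apply/SE; split=> [i j|]; first by rewrite !mxE mulr1 invr_ge0 ltW.
  by have := QZ n%:R^-1 _ _ QJ; rewrite mulVf.
have SP : S (b^-1 *: (k *: const_mx 1 + M)).
  apply/SE; split=> [i j|].
    rewrite !mxE mulr1 mulr_ge0 ?invr_ge0 ?(ltW b_gt0)//.
    have := le_entry_sum_norm M i j; rewrite /k.
    have := normr_ge0 a; lra.
  have := QZ b^-1 _ _ (Qlin k _ _ _ _ QJ QM).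
  by rewrite [k * _ + a]addrC mulVf ?lt0r_neq0.
have -> : M = b *: (b^-1 *: (k *: const_mx 1 + M))
              + (- (k * n%:R)) *: (n%:R^-1 *: const_mx 1).
  rewrite !scalerA divff ?lt0r_neq0// scale1r mulNr mulfK// scaleNr.
  by rewrite addrAC subrr add0r.
exact: linear_span_comb2.
Qed.

Lemma row_sums_lin k a b A B :
  A *m ones R n = a *: ones R n -> B *m ones R n = b *: ones R n ->
  (k *: A + B) *m ones R n = (k * a + b) *: ones R n.
Proof. by move=> hA hB; rewrite mulmxDl -scalemxAl hA hB scalerA scalerDl. Qed.

Lemma row_sums_const1 : const_mx 1 *m ones R n = n%:R *: ones R n.
Proof.
apply/mulmx_onesE => i.
by under eq_bigr do rewrite mxE; rewrite sumr_const card_ord.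
Qed.

Lemma linear_span_row_stochastic : (0 < n)%N ->
  linear_span (row_stochastic R n) =
    [set M | exists a, M *m ones R n = a *: ones R n].
Proof.
move=> n0.
apply: (linear_span_line_sums (Q := fun a M => M *m ones R n = a *: ones R n)).
- exact: n0.
- exact: row_sums_lin.
- exact: row_sums_const1.
- by move=> A; rewrite mulmx_onesE.
Qed.

Lemma linear_span_col_stochastic : (0 < n)%N ->
  linear_span (col_stochastic R n) =
    [set M | exists a, M^T *m ones R n = a *: ones R n].
Proof.
move=> n0.
apply: (linear_span_line_sums
          (Q := fun a M => M^T *m ones R n = a *: ones R n)).
- exact: n0.
- by move=> k a b A B hA hB; rewrite linearP; apply: row_sums_lin.
- by rewrite trmx_const; exact: row_sums_const1.
- by move=> A; rewrite trmx_onesE.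
Qed.

Lemma linear_span_doubly_stochastic : (0 < n)%N ->
  linear_span (doubly_stochastic R n) =
    [set M | exists a, M *m ones R n = a *: ones R n
                       /\ M^T *m ones R n = a *: ones R n].
Proof.
move=> n0.
apply: (linear_span_line_sums
          (Q := fun a M => M *m ones R n = a *: ones R n
                           /\ M^T *m ones R n = a *: ones R n)).
- exact: n0.
- move=> k a b A B [hA hA'] [hB hB'].
  by rewrite linearP; split; apply: row_sums_lin.
- by rewrite trmx_const; split; exact: row_sums_const1.
- move=> A; rewrite mulmx_onesE trmx_onesE.
  by split=> [[[? ?] [? ?]]|[? [? ?]]].
Qed.

End LineSums.

(** * Block form in an orthogonal frame *)

Section OrthogonalFrame.
Variables (F : fieldType) (p q : nat).
Variables (u : 'M[F]_(p + q, p)) (X : 'M[F]_(p + q, q)).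
Let U : 'M[F]_(p + q) := row_mx u X.
Hypothesis U_orth : U^T *m U = 1%:M.

Lemma invmx_frame : invmx U = U^T.
Proof.
have [_ Uu] := mulmx1_unit U_orth.
by rewrite -[LHS]mul1mx -U_orth -mulmxA mulmxV// mulmx1.
Qed.

Lemma frame_gram :
  [/\ u^T *m u = 1%:M, u^T *m X = 0, X^T *m u = 0 & X^T *m X = 1%:M].
Proof.
move: U_orth; rewrite /U tr_row_mx mul_col_row scalar_mx_block.
by case/eq_block_mx.
Qed.

Lemma frame_block (M : 'M[F]_(p + q)) :
  M = U *m block_mx (u^T *m M *m u) (u^T *m M *m X)
                    (X^T *m M *m u) (X^T *m M *m X) *m invmx U.
Proof.
rewrite -mul_col_row -mul_col_mx -tr_row_mx invmx_frame !mulmxA.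
have UUT : U *m U^T = 1%:M by apply/mulmx1C.
by rewrite UUT mul1mx -mulmxA UUT mulmx1.
Qed.

(** The first block column of [U^T M U] is [U^T (M u)], and [U^T u] is the
    first block column of the identity.  Keeping [a] on both sides, rather than
    quantifying over it, lets the row and the column conditions share it. *)
Lemma frame_right_eigenP (M : 'M[F]_(p + q)) (a : F) :
  M *m u = a *: u <->
  exists B r, M = U *m block_mx a%:M r 0 B *m invmx U.
Proof.
have [uu uX Xu XX] := frame_gram; split=> [Mu|[B [r ->]]].
  exists (X^T *m M *m X), (u^T *m M *m X); rewrite {1}(frame_block M).
  by rewrite -!(mulmxA _ M u) Mu -!scalemxAr uu Xu scaler0 scalemx1.
rewrite invmx_frame -mulmxA {2}/U tr_row_mx mul_col_mx uu Xu.
rewrite -mulmxA mul_block_col !mulmx0 mul0mx !addr0 mulmx1.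
by rewrite /U mul_row_col mulmx0 addr0 mul_mx_scalar.
Qed.

Lemma trmx_frame_block (M : 'M[F]_(p + q)) (N : 'M[F]_(p + q)) :
  M^T = U *m N *m invmx U <-> M = U *m N^T *m invmx U.
Proof.
rewrite invmx_frame; split=> [H|->].
  by rewrite -[M]trmxK H !trmx_mul trmxK mulmxA.
by rewrite !trmx_mul !trmxK mulmxA.
Qed.

(** Transposing [M] transposes its block form, because [U^T] is the inverse of
    [U]; so this is the previous criterion for [M^T]. *)
Lemma frame_left_eigenP (M : 'M[F]_(p + q)) (a : F) :
  M^T *m u = a *: u <->
  exists B c, M = U *m block_mx a%:M 0 c B *m invmx U.
Proof.
rewrite frame_right_eigenP; split=> [[B [r]]|[B [c ME]]].
  move/trmx_frame_block; rewrite tr_block_mx tr_scalar_mx trmx0 => ->.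
  by exists B^T, r^T.
exists B^T, c^T; apply/trmx_frame_block.
by rewrite tr_block_mx tr_scalar_mx trmx0 !trmxK.
Qed.

Lemma frame_biblock (M : 'M[F]_(p + q)) (a : F) :
  M *m u = a *: u -> M^T *m u = a *: u ->
  M = U *m block_mx a%:M 0 0 (X^T *m M *m X) *m invmx U.
Proof.
have [uu uX Xu XX] := frame_gram => Mu MTu.
have uM : u^T *m M = a *: u^T.
  by rewrite -[LHS]trmxK trmx_mul trmxK MTu linearZ.
rewrite {1}(frame_block M) uM -!(mulmxA _ M u) Mu.
by rewrite -!scalemxAr -!scalemxAl Xu uX uu !scaler0 scalemx1.
Qed.

Lemma frame_biblockP (M : 'M[F]_(p + q)) (a : F) :
  (M *m u = a *: u /\ M^T *m u = a *: u) <->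
  exists B, M = U *m block_mx a%:M 0 0 B *m invmx U.
Proof.
split=> [[Mu MTu]|[B ME]]; first by eexists; apply: frame_biblock.
by split; [apply/frame_right_eigenP|apply/frame_left_eigenP]; exists B, 0.
Qed.

(** Only the blocks in the first block row survive because [X^T u = 0], and the
    first of them vanishes because [x] is orthogonal to [u].  The factor [v]
    accommodates the scalar relating [e] to its normalization [u]. *)
Lemma frame_outer_row (x : 'rV[F]_(p + q)) (v : 'cV[F]_p) :
  x *m u = 0 -> u *m v *m x = U *m block_mx 0 (v *m (x *m X)) 0 0 *m invmx U.
Proof.
have [uu _ Xu _] := frame_gram => xu.
rewrite {1}(frame_block (u *m v *m x)) !mulmxA uu Xu !mul0mx mul1mx.
by rewrite -!(mulmxA _ x) xu mulmx0.
Qed.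

Lemma frame_outer_col (x : 'cV[F]_(p + q)) (v : 'rV[F]_p) :
  u^T *m x = 0 ->
  x *m v *m u^T = U *m block_mx 0 0 (X^T *m x *m v) 0 *m invmx U.
Proof.
have [uu uX _ _] := frame_gram => ux.
rewrite {1}(frame_block (x *m v *m u^T)) !mulmxA ux !mul0mx.
by rewrite -!(mulmxA _ u^T) uu uX !mulmx0 mulmx1.
Qed.

End OrthogonalFrame.

(** * The doubly stochastic, row and column parts *)

Section Decomposition.
Variables (R : realType) (n : nat).
Hypothesis n_gt0 : (0 < n)%N.
Implicit Type A : 'M[R]_n.

Let n_neq0 : n%:R != 0 :> R.
Proof. by rewrite pnatr_eq0 -lt0n. Qed.

Lemma mx_meanE A : n%:R * mx_mean A = n%:R^-1 * \sum_i \sum_j A i j.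
Proof. by rewrite /mx_mean expr2 invfM !mulrA divff// mul1r. Qed.

Lemma mx_mean_tr A : mx_mean A^T = mx_mean A.
Proof.
rewrite /mx_mean exchange_big /=; congr (_ * _).
by do 2![apply: eq_bigr => ? _]; rewrite mxE.
Qed.

(** Transposition exchanges rows and columns, so every fact on [r(A)] or on
    column sums follows from its counterpart for [c(A)] and row sums. *)
Lemma c_vec_tr A : c_vec A^T = r_vec A.
Proof.
apply/matrixP => i j; rewrite !mxE mx_mean_tr; congr (_ * _ - _).
by apply: eq_bigr => k _; rewrite mxE.
Qed.

Lemma DS_part_tr A : (DS_part A)^T = DS_part A^T.
Proof.
have r_vec_tr : r_vec A^T = c_vec A by rewrite -c_vec_tr trmxK.
rewrite /DS_part /R_part /C_part c_vec_tr r_vec_tr !linearB /=.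
by rewrite !trmx_mul !trmxK addrAC.
Qed.

Lemma ones_c_vec A : (ones R n)^T *m c_vec A = 0.
Proof.
apply/matrixP => i j; rewrite !mxE.
under eq_bigr do rewrite !mxE mul1r.
rewrite sumrB -mulr_sumr sumr_const card_ord -(mulr_natl (mx_mean A)) mx_meanE.
exact: subrr.
Qed.

Lemma r_vec_ones A : (r_vec A)^T *m ones R n = 0.
Proof. by rewrite -[LHS]trmxK trmx_mul trmxK -c_vec_tr ones_c_vec trmx0. Qed.

(** Since [r(A)] is orthogonal to [e], subtracting [A_R] preserves the row sums
    [n (c_i + s_A)] of [A]; subtracting [A_C] then removes [n c_i]. *)
Lemma DS_part_ones A :
  DS_part A *m ones R n = (n%:R * mx_mean A) *: ones R n.
Proof.
have oo : (ones R n)^T *m ones R n = n%:R%:M.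
  apply/matrixP => i j; rewrite !ord1 !mxE.
  by under eq_bigr do rewrite !mxE mulr1; rewrite sumr_const card_ord.
rewrite /DS_part /R_part /C_part !mulmxBl -!mulmxA r_vec_ones oo mulmx0 subr0.
rewrite mul_mx_scalar; apply/matrixP => i j; rewrite !mxE mulr1 mulrBr.
under eq_bigr do rewrite mxE mulr1.
by rewrite mulVKf// opprB addrC subrK.
Qed.

Lemma DS_part_tr_ones A :
  (DS_part A)^T *m ones R n = (n%:R * mx_mean A) *: ones R n.
Proof. by rewrite DS_part_tr DS_part_ones mx_mean_tr. Qed.

End Decomposition.

(* The dimension is n = 1 + m, so that block_mx splits off the first row and
   column. *)
Theorem theorem2p3 (R : realType) (m : nat) (hn : (2 <= 1 + m)%N)
    (X : 'M[R]_(1 + m, m)) (U : 'M[R]_(1 + m))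
    (hU : U = row_mx ((Num.sqrt (1 + m)%:R)^-1 *: ones R (1 + m)) X)
    (hUorth : orthogonal_mx U) :
  [/\ linear_span (doubly_stochastic R (1 + m)) =
        [set M | exists (a : R) (B : 'M[R]_m),
           M = U *m block_mx a%:M 0 0 B *m invmx U],
      linear_span (row_stochastic R (1 + m)) =
        [set M | exists (a : R) (B : 'M[R]_m) (r : 'cV[R]_m),
           M = U *m block_mx a%:M r^T 0 B *m invmx U],
      linear_span (col_stochastic R (1 + m)) =
        [set M | exists (a : R) (B : 'M[R]_m) (c : 'cV[R]_m),
           M = U *m block_mx a%:M 0 c B *m invmx U]
    & forall A : 'M[R]_(1 + m),
      [/\ A = DS_part A + R_part A + C_part A,
          DS_part A =
            U *m block_mx ((1 + m)%:R * mx_mean A)%:M 0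
                          0 (X^T *m DS_part A *m X) *m invmx U,
          R_part A =
            U *m block_mx 0 (Num.sqrt (1 + m)%:R *: ((r_vec A)^T *m X))
                          0 0 *m invmx U
        & C_part A =
            U *m block_mx 0 0
                          (Num.sqrt (1 + m)%:R *: (X^T *m c_vec A)) 0
              *m invmx U]].
Proof.
have n0 : (0 < 1 + m)%N by [].
set s : R := Num.sqrt _ in hU *.
have s_neq0 : s != 0 by rewrite gt_eqF// sqrtr_gt0 ltr0n.
set u := s^-1 *: _ in hU.
have onesE : ones R (1 + m) = s *: u by rewrite scalerA divff// scale1r.
have eigE (M : 'M[R]_(1 + m)) (a : R) :
    M *m ones R (1 + m) = a *: ones R (1 + m) <-> M *m u = a *: u.
  rewrite /u -scalemxAr scalerA (mulrC a) -scalerA; split=> [->//|].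
  by move/scalerI; apply; rewrite invr_eq0.
rewrite {}hU {U} in hUorth *.
split.
- rewrite linear_span_doubly_stochastic//; apply/seteqP; split=> M /=.
    move=> [a]; rewrite !eigE => /(frame_biblockP hUorth)[B ->].
    by exists a, B.
  move=> [a [B ME]]; exists a; rewrite !eigE.
  by apply/(frame_biblockP hUorth); exists B.
- rewrite linear_span_row_stochastic//; apply/seteqP; split=> M /=.
    move=> [a]; rewrite eigE => /(frame_right_eigenP hUorth)[B [r ->]].
    by exists a, B, r^T; rewrite trmxK.
  move=> [a [B [r ME]]]; exists a; rewrite eigE.
  by apply/(frame_right_eigenP hUorth); exists B, r^T.
- rewrite linear_span_col_stochastic//; apply/seteqP; split=> M /=.
    move=> [a]; rewrite eigE => /(frame_left_eigenP hUorth)[B [c ->]].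
    by exists a, B, c.
  move=> [a [B [c ME]]]; exists a; rewrite eigE.
  by apply/(frame_left_eigenP hUorth); exists B, c.
- move=> A; split.
  + by rewrite /DS_part addrAC !subrK.
  + by apply: (frame_biblock hUorth); apply/eigE;
      [apply: DS_part_ones|apply: DS_part_tr_ones].
  + have ru : (r_vec A)^T *m u = 0 by rewrite /u -scalemxAr r_vec_ones// scaler0.
    have := frame_outer_row hUorth s%:M ru.
    by rewrite mul_mx_scalar mul_scalar_mx /R_part onesE.
  + have uc : u^T *m c_vec A = 0.
      by rewrite /u linearZ /= -scalemxAl ones_c_vec// scaler0.
    have := frame_outer_col hUorth s%:M uc.
    have onesT : (ones R (1 + m))^T = s *: u^T by rewrite onesE [LHS]linearZ.
    by rewrite !mul_mx_scalar -scalemxAl /C_part onesT -scalemxAr.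
Qed.
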